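(* Let $G$ be a non-discrete compact group with normalized Haar measure $\nu$ ($\nu(G)=1$). For every neighborhood $U$ of the identity of $G$ there exists a $U$-fine equisize partition of $G$.
   Context: A finite partition $\mathcal P$ of a set $X\subseteq G$ into Haar-measurable sets is called $U$-fine if for every $P\in\mathcal P$ there is $g\in G$ with $P\subseteq gU$, and equisize if all sets in $\mathcal P$ have the same Haar measure. *)

(* Defs.v *)
From mathcomp Require Import all_boot all_order all_algebra.
From mathcomp Require Import all_classical all_reals all_analysis.
Set Implicit Arguments. Unset Strict Implicit. Unset Printing Implicit Defensive.
Import Order.TTheory GRing.Theory Num.Theory.
Local Open Scope classical_set_scope.
Local Open Scope ring_scope.

Definition is_topological_group (G : ptopologicalType)
  (mul : G -> G -> G) (inv : G -> G) (e : G) : Prop :=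
  [/\ (forall x y z, mul x (mul y z) = mul (mul x y) z),
      (forall x, mul e x = x),
      (forall x, mul (inv x) x = e),
      continuous (fun p : G * G => mul p.1 p.2)
    & continuous inv].

Definition is_compact_group (G : ptopologicalType)
  (mul : G -> G -> G) (inv : G -> G) (e : G) : Prop :=
  [/\ is_topological_group mul inv e, hausdorff_space G & compact [set: G]].

Notation borel G := (g_sigma_algebraType (@open G)).

Definition is_normalized_haar (R : realType) (G : ptopologicalType)
  (mul : G -> G -> G) (nu : probability (borel G) R) : Prop :=
  [/\ (forall (g : G) (A : set (borel G)), measurable A ->
          nu ((mul g) @` A) = nu A),
      (forall A : set (borel G), measurable A ->
          nu A = ereal_inf [set nu O | O in [set O : set (borel G) | @open G O /\ A `<=` O]])
    & (forall O : set (borel G), @open G O ->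
          nu O = ereal_sup [set nu K | K in [set K : set (borel G) | @compact G K /\ K `<=` O]])].

(* Haar-measurable sets: measurable for the completion of nu, i.e.
   sandwiched between two Borel sets whose difference is nu-null.
   haar_measure_is nu P c : P is Haar-measurable with (completed) measure c. *)
Definition haar_measure_is (R : realType) (G : ptopologicalType)
  (nu : probability (borel G) R) (P : set G) (c : \bar R) : Prop :=
  exists (A B : set (borel G)), [/\ measurable A, measurable B,
    A `<=` P /\ P `<=` B, nu (B `\` A) = 0%E & nu A = c].

Definition haar_measurable (R : realType) (G : ptopologicalType)
  (nu : probability (borel G) R) (P : set G) : Prop :=
  exists c, haar_measure_is nu P c.

Definition finite_partition (T : Type) (X : set T) (Pp : set (set T)) : Prop :=
  [/\ finite_set Pp,
      ~ Pp set0,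
      (forall P Q, Pp P -> Pp Q -> P <> Q -> P `&` Q = set0)
    & \bigcup_(P in Pp) P = X].

Definition U_fine (G : Type) (mul : G -> G -> G) (U : set G) (Pp : set (set G)) :=
  forall P, Pp P -> exists g : G, P `<=` (mul g) @` U.

Definition equisize (R : realType) (G : ptopologicalType)
  (nu : probability (borel G) R) (Pp : set (set G)) :=
  exists c : \bar R, forall P, Pp P -> haar_measure_is nu P c.

(* Main.v *)
(**
  A non-discrete compact group has atomless Haar measure, so every measurable
  set can be cut into measurable subsets of prescribed measures.  Let [V] be a
  small open symmetric neighborhood of [e] and [H] the open subgroup it
  generates.  Greedily choose [h_0 = e, h_1, ...] in [H] with disjoint
  translates [h_i V], each new point being taken in [h_j V^3] for an earlier
  [h_j]; when the process stops, the sets [h_i V^2] cover [H], and they can be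
  shrunk to a partition of [H] into cells between [h_i V] and [h_i V^2].
  Let [delta = nu(H)/N <= nu(V)].  Going through the cells backwards, cut the
  [i]-th cell into sets of measure [delta] and hand the remainder, taken from
  [h_i V^2], over to the cell of the earlier neighbor [h_j]: it fits into
  [h_j U].  The last cell left has measure a multiple of [delta] because [H]
  has.  Translating this partition to the finitely many cosets of [H] finishes
  the proof.
*)
Require Import Defs.
From mathcomp Require Import all_boot all_order all_algebra.
From mathcomp Require Import all_classical all_reals all_analysis.
From mathcomp Require Import finmap lra.
Import Order.TTheory GRing.Theory Num.Theory.
Local Open Scope classical_set_scope.
Set Implicit Arguments.
Unset Strict Implicit.
Unset Printing Implicit Defensive.

(** * Subsets of prescribed measure in an atomless probability space *)

Section Splitting.
Local Open Scope ring_scope.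
Context (d : measure_display) (T : measurableType d) (R : realType)
  (mu : probability T R).
Implicit Types (A B C S : set T) (eps delta t : R).

Definition mass A : R := fine (mu A).

Lemma massE A : measurable A -> mu A = (mass A)%:E.
Proof. by move=> mA; rewrite fineK// fin_num_measure. Qed.

Lemma mass_set0 : mass set0 = 0.
Proof. by rewrite /mass measure0. Qed.

Lemma mass_ge0 A : 0 <= mass A.
Proof. by rewrite fine_ge0. Qed.

Lemma massU A B : measurable A -> measurable B -> A `&` B = set0 ->
  mass (A `|` B) = mass A + mass B.
Proof.
by move=> mA mB AB0; rewrite /mass measureU// fineD// fin_num_measure.
Qed.

Lemma mass_setD A B : measurable A -> measurable B -> B `<=` A ->
  mass (A `\` B) = mass A - mass B.
Proof.
move=> mA mB BA; apply/eqP; rewrite eq_sym subr_eq addrC; apply/eqP.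
by rewrite -massU ?setDUK ?setDIK//; exact: measurableD.
Qed.

Lemma le_mass A B : measurable A -> measurable B -> A `<=` B ->
  mass A <= mass B.
Proof.
by move=> mA mB AB; have := mass_ge0 (B `\` A); rewrite mass_setD// subr_ge0.
Qed.

Lemma massU_le A B : measurable A -> measurable B ->
  mass (A `|` B) <= mass A + mass B.
Proof.
move=> mA mB; have mBA : measurable (B `\` A) by exact: measurableD.
rewrite (_ : A `|` B = A `|` (B `\` A)); last first.
  by rewrite setUDr setDv setD0.
by rewrite massU ?setDIK// lerD2l le_mass//; exact: subDsetl.
Qed.

(** A form of atomlessness: only the first [n] sets have to cover, and they may overlap. *)
Definition finely_coverable := forall eps, 0 < eps ->
  exists n (F : nat -> set T),
    (forall i, measurable (F i) /\ mass (F i) <= eps) /\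
    (forall x, exists2 i, (i < n)%N & F i x).

Hypothesis fine_cover : finely_coverable.

(** Add the traces of the [F i] on [A] one at a time until the mass reaches [t - eps]. Each raises
    it by at most [eps], so [t] is not exceeded; if the threshold is never reached, all of [A] has
    been collected. *)
Lemma approx_subset A t eps : measurable A -> 0 <= t -> t <= mass A ->
  0 < eps ->
  exists B, [/\ measurable B, B `<=` A, mass B <= t & t - eps <= mass B].
Proof.
move=> mA t0 tA eps0; have [n [F [Fsmall Fcov]]] := fine_cover eps0.
have : exists B, [/\ measurable B, B `<=` A, mass B <= t &
    t - eps <= mass B \/ forall x i, (i < n)%N -> A x -> F i x -> B x].
  elim: n {Fcov} => [|n [B [mB BA Bt [Blarge|Bfull]]]].
  - by exists set0; split => //; [rewrite mass_set0|right].
  - by exists B; split=> //; left.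
  have [Blarge|Bsmall] := leP (t - eps) (mass B).
    by exists B; split=> //; left.
  have [mF Fe] := Fsmall n.
  have mFA : measurable (F n `&` A) by exact: measurableI.
  exists (B `|` (F n `&` A)); split.
  - exact: measurableU.
  - by move=> x [/BA|[]].
  - have := massU_le mB mFA.
    have : mass (F n `&` A) <= mass (F n).
      by apply: le_mass => //; exact: subIsetl.
    lra.
  - right=> x i; rewrite ltnS leq_eqVlt => /predU1P[->|lt_in] Ax Fx.
      by right.
    by left; exact: Bfull Fx.
move=> [B [mB BA Bt [Blarge|Bfull]]]; exists B; split=> //.
have -> : B = A.
  apply/seteqP; split=> // x Ax; have [i lt_in Fx] := Fcov x.
  exact: Bfull Fx.
lra.
Qed.

Lemma approx_between A B t eps : measurable A -> measurable B -> B `<=` A ->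
  mass B <= t -> t <= mass A -> 0 < eps ->
  exists C, [/\ measurable C, B `<=` C, C `<=` A, mass C <= t
    & t - eps <= mass C].
Proof.
move=> mA mB BA Bt tA eps0.
have mAB : measurable (A `\` B) by exact: measurableD.
have [||//|C [mC CAB Ct tC]] := @approx_subset _ (t - mass B) eps mAB.
- by rewrite subr_ge0.
- by rewrite mass_setD// lerD2r.
have BC0 : B `&` C = set0 by rewrite -subset0 => x [Bx /CAB[]].
exists (B `|` C); rewrite massU//; split.
- exact: measurableU.
- by move=> x; left.
- by move=> x [/BA|/CAB[]].
- lra.
- lra.
Qed.

(** Take nested subsets of mass at most [t] whose defects are bounded by [1/(n+1)]. Continuity from
    below bounds the mass of their union by [t], and monotonicity gives the converse inequality. *)
Lemma exact_subset A t : measurable A -> 0 <= t -> t <= mass A ->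
  exists B, [/\ measurable B, B `<=` A & mass B = t].
Proof.
move=> mA t0 tA.
pose good B := [/\ measurable B, B `<=` A & mass B <= t].
(* The implication sits under the existential so that [choice] yields a total function; a pair that
   is not [good] gets the junk value [set0]. *)
have step (nB : nat * set T) : exists C, good nB.2 ->
    [/\ good C, nB.2 `<=` C & t - nB.1.+1%:R^-1 <= mass C].
  have [[mB BA Bt]|/not_and3P nB_good] := pselect (good nB.2).
    have eps0 : 0 < nB.1.+1%:R^-1 :> R by rewrite invr_gt0.
    have [C [mC BC CA Ct tC]] := approx_between mA mB BA Bt tA eps0.
    by exists C.
  by exists set0 => -[? ? ?]; case: nB_good.
have [f fP] := choice step.
pose Bs := fix Bs n := if n is m.+1 then f (m, Bs m) else set0.
have Bs_good n : good (Bs n).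
  elim: n => [|n IHn] /=; first by split=> //; rewrite mass_set0.
  by have [] := fP (n, Bs n) IHn.
have mBs n : measurable (Bs n) by have [] := Bs_good n.
have Bs_incr : {homo Bs : n m / (n <= m)%N >-> (n <= m)%O}.
  apply: homo_leq => [x|y x z|n]; [exact: lexx|exact: le_trans|].
  by apply/subsetPset; have [] := fP (n, Bs n) (Bs_good n).
have mB : measurable (\bigcup_n Bs n) by exact: bigcup_measurable.
exists (\bigcup_n Bs n); split=> //.
  by move=> x [n _]; have [_ + _] := Bs_good n; exact.
apply/eqP; rewrite eq_le; apply/andP; split.
  have cvgB : mu (Bs n) @[n --> \oo] --> (mass (\bigcup_n Bs n))%:E.
    by rewrite -massE//; exact: nondecreasing_cvg_mu.
  rewrite -lee_fin -(cvg_lim _ cvgB)//; apply: lime_le.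
    by apply/cvg_ex; exists (mass (\bigcup_n Bs n))%:E.
  by apply: nearW => n /=; rewrite massE// lee_fin; have [] := Bs_good n.
apply/ler_addgt0Pr => eps eps0; rewrite -lerBlDr.
have [n /ltW n_eps] : exists n, n.+1%:R^-1 < eps :> R.
  have [n _ /(_ n)] := near_infty_natSinv_lt (PosNum eps0).
  by move=> /(_ (leqnn n)) ?; exists n.
have tB : t - n.+1%:R^-1 <= mass (Bs n.+1).
  by have [] := fP (n, Bs n) (Bs_good n).
apply: le_trans (le_trans tB _); first by rewrite lerB.
by apply: le_mass => //; exact: bigcup_sup.
Qed.

End Splitting.

(** * Unions and chains along a list of indices *)

Section UnionOver.
Context (T : Type) (I : eqType).
Implicit Types (s : seq I) (A : I -> set T).

Definition union_over s A : set T :=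
  [set x | exists2 i, i \in s & A i x].

Definition disjoint_over s A :=
  {in s &, forall i j, i <> j -> A i `&` A j = set0}.

Lemma union_over_cons i s A :
  union_over (i :: s) A = A i `|` union_over s A.
Proof.
apply/seteqP; split=> x.
- by move=> [j]; rewrite inE => /predU1P[->|js] Ax; [left|right; exists j].
- move=> [Ax|[j js Ax]]; first by exists i => //; rewrite mem_head.
  by exists j => //; rewrite inE js orbT.
Qed.

(* The list has its most recent element first. *)
Fixpoint chained (C star : I -> set T) (s : seq I) : Prop :=
  if s is i :: s' then
    (s' = [::] \/ exists2 p, p \in s' & C i `<=` star p) /\ chained C star s'
  else True.

End UnionOver.

Lemma measurable_union_over (d : measure_display)
    (T : measurableType d) (I : eqType) (s : seq I) (A : I -> set T) :
  {in s, forall i, measurable (A i)} -> measurable (union_over s A).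
Proof.
move=> mA; rewrite (_ : union_over s A = \bigcup_(i in [set` s]) A i)//.
by apply: fin_bigcup_measurable => // i; exact: mA.
Qed.

(** * Partitions into pieces of equal mass *)

Section Tiling.
Local Open Scope ring_scope.
Context (d : measure_display) (T : measurableType d) (R : realType)
  (mu : probability T R) (Q : set T -> Prop) (delta : R).
Hypothesis delta_gt0 : 0 < delta.
Implicit Types (A B C S : set T).
Local Notation mass := (mass mu).

(** [Q] stands for the fineness condition, so that no group structure enters here. *)
Definition tiled S := exists Pp : set (set T), finite_partition S Pp /\
  forall P, Pp P -> [/\ measurable P, mass P = delta & Q P].

Lemma tiled0 : tiled set0.
Proof.
by exists set0; split=> //; split=> //; rewrite bigcup_set0.
Qed.

Lemma tiled1 S : measurable S -> mass S = delta -> Q S -> tiled S.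
Proof.
move=> mS Sdelta QS; exists [set S]; split; last by move=> _ ->.
split; first exact: finite_set1.
- move=> /= S0; move: Sdelta delta_gt0.
  by rewrite -S0 mass_set0 => <-; rewrite ltxx.
- by move=> _ _ -> ->.
- by rewrite bigcup_set1.
Qed.

Lemma tiledU A B : A `&` B = set0 -> tiled A -> tiled B -> tiled (A `|` B).
Proof.
move=> AB0 [PA [[fA nA tA UA] hA]] [PB [[fB nB tB UB] hB]].
have cross P P' : PA P -> PB P' -> P `&` P' = set0.
  move=> PP PP'; rewrite -subset0 -AB0 -UA -UB => x [Px P'x].
  by split; [exists P|exists P'].
exists (PA `|` PB); split; last by move=> P [/hA|/hB].
split.
- by rewrite finite_setU.
- by case.
- move=> P P' [P1|P1] [P2|P2] PP'; [exact: tA|exact: cross| |exact: tB].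
  by rewrite setIC; exact: cross.
- by rewrite bigcup_setU UA UB.
Qed.

Hypothesis fine_cover : finely_coverable mu.

(** Split off one piece of mass [delta] at a time. For [q = 0] the claim would fail on a nonempty
    null set, since pieces have positive mass. *)
Lemma tiled_cut (q : nat) S : (0 < q)%N -> measurable S ->
  mass S = q%:R * delta -> (forall P, P `<=` S -> Q P) -> tiled S.
Proof.
case: q => // q _; elim: q S => [|q IHq] S mS massS QS.
  by apply: tiled1 => //; [rewrite massS mul1r|exact: QS].
have dS : delta <= mass S by rewrite massS ler_peMl ?ler1n// ltW.
have [P [mP PS massP]] := exact_subset fine_cover mS (ltW delta_gt0) dS.
rewrite -(setDUK PS); apply: tiledU; first by rewrite setDIK.
  by apply: tiled1 => //; exact: QS.
apply: IHq; first exact: measurableD.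
  by rewrite mass_setD// massS massP -natr1 mulrDl mul1r addrK.
by move=> P' P'S; apply: QS => x /P'S[].
Qed.

(** The newest cell [A i] is cut into [k] pieces and its remainder goes to the parent [p]. Taking
    the remainder inside the core [C i] keeps the enlarged cell of [p] within [star p], while
    anything [A i] inherited earlier need only lie in [star i]. The lower bound on the mass of [A i]
    within [C i] leaves room for the remainder and survives when cells grow. *)
Lemma tiled_chain (I : eqType) (C star : I -> set T) (s : seq I)
    (A : I -> set T) (q : nat) :
  (forall i P, P `<=` star i -> Q P) ->
  uniq s -> chained C star s ->
  {in s, forall i, measurable (C i)} ->
  {in s, forall i, [/\ measurable (A i), A i `<=` star i
                    & delta <= mass (A i `&` C i)]} ->
  disjoint_over s A ->
  mass (union_over s A) = q%:R * delta ->
  tiled (union_over s A).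
Proof.
move=> Qstar; elim: s A q => [|i s IHs] A q.
  move=> _ _ _ _ _ _; rewrite (_ : union_over _ _ = set0); first exact: tiled0.
  by rewrite -subset0 => x [].
move=> /= /andP[i_notin uniq_s] [parent chain_s] mC hA disjA.
have [mAi Ai_star core_i] := hA i (mem_head _ _).
have mCi := mC i (mem_head _ _).
have mACi : measurable (A i `&` C i) by exact: measurableI.
have Ai_ge : delta <= mass (A i).
  by apply: le_trans core_i _; apply: le_mass => //; exact: subIsetl.
have hAs : {in s, forall j, [/\ measurable (A j), A j `<=` star j
    & delta <= mass (A j `&` C j)]}.
  by move=> j js; apply: hA; rewrite inE js orbT.
have mUs : measurable (union_over s A).
  by apply: measurable_union_over => j /hAs[].
have disj_i : A i `&` union_over s A = set0.
  rewrite -subset0 => x [Aix [j js Ajx]].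
  rewrite -(disjA i j (mem_head _ _) _ _); first by split.
    by rewrite inE js orbT.
  by move=> ij; move: i_notin; rewrite ij js.
rewrite union_over_cons massU// => total.
(* The oldest cell has no parent, but then it is the whole union, whose mass is a multiple of
   [delta]. *)
case: parent => [s0|[p ps Cip]].
  rewrite s0 in total *.
  have U0 : union_over [::] A = set0 by rewrite -subset0 => x [].
  move: total; rewrite U0 setU0 mass_set0 addr0 => total.
  apply: (@tiled_cut q) => //; last first.
    by move=> P PA; apply: (Qstar i) => x /PA/Ai_star.
  rewrite lt0n; apply: contraTneq Ai_ge => q0.
  by rewrite total q0 mul0r -ltNge.
have /andP[k_le k_gt] :=
  truncn_itv (divr_ge0 (mass_ge0 mu (A i)) (ltW delta_gt0)).
set k := Num.truncn _ in k_le k_gt.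
rewrite ler_pdivlMr// in k_le; rewrite ltr_pdivrMr// in k_gt.
have k_gt0 : (0 < k)%N.
  rewrite lt0n; apply: contraTneq k_gt => ->; rewrite mul1r -leNgt //.
have r_ge0 : 0 <= mass (A i) - k%:R * delta by rewrite subr_ge0.
(* The remainder is below [delta], so it fits into the core. *)
have r_le : mass (A i) - k%:R * delta <= mass (A i `&` C i).
  by move: k_gt; rewrite -natr1 mulrDl mul1r; lra.
have [Rm [mRm RmAC massRm]] := exact_subset fine_cover mACi r_ge0 r_le.
have RmA : Rm `<=` A i by move=> x /RmAC[].
pose A' j := if j == p then A p `|` Rm else A j.
have UA' : union_over s A' = union_over s A `|` Rm.
  apply/seteqP; split=> x.
  - move=> [j js]; rewrite /A'; case: eqP => _ => [[Apx|Rx]|Ajx].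
    + by left; exists p.
    + by right.
    + by left; exists j.
  - move=> [[j js Ajx]|Rx].
    + by exists j => //; rewrite /A'; case: eqP => // jp; left; rewrite -jp.
    + by exists p => //; rewrite /A' eqxx; right.
have disjR j : j \in s -> A j `&` Rm = set0.
  move=> js; rewrite -subset0 -disj_i => x [Ajx /RmA Aix].
  by split=> //; exists j.
rewrite (_ : _ `|` _ = (A i `\` Rm) `|` union_over s A'); last first.
  by rewrite UA' -[in LHS](setDUK RmA) setUA [Rm `|` _]setUC setUAC.
apply: tiledU.
- rewrite UA' setIUr -subset0 => x [[[Ax _] Ux]|[[_ nR] //]].
  by rewrite -disj_i.
- apply: (@tiled_cut k) => //; first exact: measurableD.
    by rewrite mass_setD// massRm; lra.
  by move=> P PA; apply: (Qstar i) => x /PA[/Ai_star].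
apply: (IHs A' (q - k)%N) => //.
- by move=> j js; apply: mC; rewrite inE js orbT.
- move=> j js; rewrite /A'; case: eqP => [->|_]; last exact: hAs.
  have [mAp Ap_star core_p] := hAs p ps; split.
  + exact: measurableU.
  + by move=> x [/Ap_star//|/RmAC[_ /Cip]].
  + have mCp : measurable (C p) by apply: mC; rewrite inE ps orbT.
    apply: le_trans core_p _; apply: le_mass; [exact: measurableI| |].
      by apply: measurableI => //; exact: measurableU.
    by move=> x [Apx Cpx]; split=> //; left.
- move=> j l js ls jl; have sub := disjA j l.
  have {}sub : A j `&` A l = set0 by apply: sub; rewrite // inE ?js ?ls orbT.
  rewrite /A'; case: eqP => [jp|_]; case: eqP => [lp|_] //.
  + by case: jl; rewrite jp lp.
  + by rewrite setIUl -jp sub set0U setIC disjR.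
  + by rewrite setIUr -lp sub set0U disjR.
- rewrite UA' massU//; last first.
    by rewrite -subset0 -disj_i => x [Ux /RmA Aix].
  (* Subtraction on [nat] truncates; this makes [q - k] the true number of pieces left. *)
  have kq : (k <= q)%N.
    rewrite -(ler_nat R) -(ler_pM2r delta_gt0) -total.
    by have := mass_ge0 mu (union_over s A); lra.
  by rewrite natrB// mulrBl massRm; lra.
Qed.

End Tiling.

(** * Disjointification and mass bounds for finite families *)

Section FiniteUnions.
Local Open Scope ring_scope.
Context (d : measure_display) (T : measurableType d) (R : realType)
  (mu : probability T R) (I : eqType).
Implicit Types (s : seq I) (A B D : I -> set T).

(** Given a solution for the tail, remove [B i] from each of its cells, which costs them nothing of
    their own [B j], and let the cell of [i] be what they leave of [D i]. *)
Lemma disjoint_between s B D : uniq s -> disjoint_over s B ->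
  {in s, forall i, [/\ measurable (B i), measurable (D i) & B i `<=` D i]} ->
  exists A, [/\ {in s, forall i, [/\ measurable (A i), B i `<=` A i
                                  & A i `<=` D i]},
    disjoint_over s A & union_over s A = union_over s D].
Proof.
elim: s => [|i s IHs] /=; first by move=> *; exists D.
move=> /andP[i_notin uniq_s] disjB hBD.
have in_s j : j \in s -> j \in i :: s by rewrite inE orbC => ->.
have neq_i j : j \in s -> i <> j by move=> + ij; rewrite -ij (negbTE i_notin).
have [||A [hA disjA UA]] := IHs uniq_s.
- by move=> j l js ls; apply: disjB; exact: in_s.
- by move=> j js; apply: hBD; exact: in_s.
have [mBi mDi BDi] := hBD i (mem_head _ _).
pose A1 j := A j `\` B i.
pose A2 j := if j == i then D i `\` union_over s A1 else A1 j.
have A2i : A2 i = D i `\` union_over s A1 by rewrite /A2 eqxx.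
have A2s j : j \in s -> A2 j = A1 j.
  by move=> /neq_i ij; rewrite /A2; case: eqP => // ji; case: ij.
have UA2 : union_over s A2 = union_over s A1.
  by apply/seteqP; split=> x [j js Ajx]; exists j => //; rewrite ?A2s// -A2s.
have mUA1 : measurable (union_over s A1).
  apply: measurable_union_over => j /hA[mAj _ _]; exact: measurableD.
exists A2; split.
- move=> j; rewrite inE => /predU1P[->|js].
    rewrite A2i; split; [exact: measurableD| |exact: subDsetl].
    by move=> x Bx; split; [exact: BDi|case=> l _ []].
  have [mAj BAj ADj] := hA j js.
  rewrite A2s//; split; [exact: measurableD| |by move=> x [/ADj]].
  move=> x Bx; split; first exact: BAj.
  move=> Bix; suff : set0 x by [].
  rewrite -(disjB i j (mem_head _ _) (in_s _ js) (neq_i _ js)).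
  by split.
- have disj_i j : j \in s -> A2 i `&` A2 j = set0.
    move=> js; rewrite A2i A2s// -subset0 => x [[_ nU] Ajx].
    by apply: nU; exists j.
  move=> j l; rewrite !inE => /predU1P[->|js] /predU1P[->|ls] // jl.
  + exact: disj_i.
  + by rewrite setIC; exact: disj_i.
  + rewrite !A2s// -subset0 -(disjA j l js ls jl) => x [[Ajx _] [Alx _]].
    by split.
- rewrite !union_over_cons UA2 A2i -UA; apply/seteqP; split=> x.
  + move=> [[Dx _]|[j js [Ajx _]]]; first by left.
    by right; exists j.
  + have [Ux|nUx] := pselect (union_over s A1 x); first by right.
    move=> [Dx|[j js Ajx]]; first by left.
    have [Bx|nBx] := pselect (B i x); first by left; split=> //; exact: BDi.
    by case: nUx; exists j.
Qed.

(** Serves to bound the length of a packing. *)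
Lemma size_disjoint_le s A (c : R) : uniq s -> disjoint_over s A ->
  {in s, forall i, measurable (A i) /\ c <= mass mu (A i)} ->
  (size s)%:R * c <= mass mu (union_over s A).
Proof.
elim: s => [|i s IHs] /=; first by rewrite mul0r mass_ge0.
move=> /andP[i_notin uniq_s] disjA hA.
have in_s j : j \in s -> j \in i :: s by rewrite inE orbC => ->.
have [mAi c_le] := hA i (mem_head _ _).
rewrite union_over_cons massU//.
- rewrite -natr1 mulrDl mul1r addrC lerD// IHs//.
    by move=> j l js ls; apply: disjA; exact: in_s.
  by move=> j js; apply: hA; exact: in_s.
- by apply: measurable_union_over => j js; have [] := hA j (in_s _ js).
- rewrite -subset0 => x [Aix [j js Ajx]].
  rewrite -(disjA i j (mem_head _ _) (in_s _ js)); first by split.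
  by move=> ij; rewrite -ij (negbTE i_notin) in js.
Qed.

Lemma mass_union_over_le s A (c : R) :
  {in s, forall i, measurable (A i) /\ mass mu (A i) <= c} ->
  mass mu (union_over s A) <= (size s)%:R * c.
Proof.
elim: s => [|i s IHs] hA.
  rewrite (_ : union_over _ _ = set0) ?mass_set0 ?mul0r//.
  by rewrite -subset0 => x [].
have [mAi le_c] := hA i (mem_head _ _).
have hAs : {in s, forall i, measurable (A i) /\ mass mu (A i) <= c}.
  by move=> j js; apply: hA; rewrite inE js orbT.
rewrite union_over_cons; apply: le_trans (massU_le _ _ _) _ => //.
  by apply: measurable_union_over => j /hAs[].
by rewrite /= -natr1 mulrDl mul1r addrC lerD// IHs.
Qed.

End FiniteUnions.

(** * Translates and neighborhoods in a topological group *)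

Section Group.
Context (G : ptopologicalType) (mul : G -> G -> G) (inv : G -> G) (e : G).
Hypothesis topG : is_topological_group mul inv e.
Implicit Types (x y z g h : G) (A U V O : set G).
Local Notation "x ** y" := (mul x y) (at level 40, left associativity).
Local Notation translate g A := (mul g @` A).

Lemma gmulA x y z : x ** (y ** z) = x ** y ** z. Proof. by case: topG. Qed.
Lemma gmul1g x : e ** x = x. Proof. by case: topG. Qed.
Lemma gmulVg x : inv x ** x = e. Proof. by case: topG. Qed.

Lemma gmulKg x y : inv x ** (x ** y) = y.
Proof. by rewrite gmulA gmulVg gmul1g. Qed.

(** Only the left axioms are given; multiplying [x ** inv x] on the left by [inv (inv x) ** inv x]
    collapses it to [e]. *)
Lemma gmulgV x : x ** inv x = e.
Proof. by rewrite -[LHS](gmulKg (inv x)) (gmulKg x) gmulVg. Qed.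

Lemma gmulVKg x y : x ** (inv x ** y) = y.
Proof. by rewrite gmulA gmulgV gmul1g. Qed.

Lemma gmulg1 x : x ** e = x.
Proof. by rewrite -(gmulVg x) gmulA gmulgV gmul1g. Qed.

Lemma gmulI g x y : g ** x = g ** y -> x = y.
Proof. by move=> gxy; rewrite -(gmulKg g x) gxy gmulKg. Qed.

Lemma ginvM x y : inv (x ** y) = inv y ** inv x.
Proof.
by apply: (@gmulI (x ** y)); rewrite gmulgV -gmulA gmulVKg gmulgV.
Qed.

(** As a preimage under a continuous map, a translate inherits openness and measurability. *)
Lemma translateE g A : translate g A = mul (inv g) @^-1` A.
Proof.
apply/seteqP; split=> [_ [x Ax <-]|x Ax] /=; first by rewrite gmulKg.
by exists (inv g ** x) => //; rewrite gmulVKg.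
Qed.

Lemma continuous_mul g : continuous (mul g).
Proof.
case: topG => _ _ _ mul_cont _ x.
apply: (@continuous_comp _ _ _ (pair g) (fun p : G * G => p.1 ** p.2)).
  by apply: cvg_pair; [exact: cvg_cst|exact: cvg_id].
exact: mul_cont.
Qed.

Lemma open_translate g A : open A -> open (translate g A).
Proof.
move=> oA; rewrite translateE.
by apply: open_comp => // x _; exact: continuous_mul.
Qed.

Lemma measurable_open A : open A -> measurable (A : set (borel G)).
Proof. exact: sub_sigma_algebra. Qed.

Lemma measurable_translate g (A : set (borel G)) :
  measurable A -> measurable (translate g A : set (borel G)).
Proof.
move=> mA; rewrite translateE.
have mf : measurable_fun setT (mul (inv g) : borel G -> borel G).
  apply: (@measurability _ _ (borel G) (borel G) setT _ (@open G) erefl).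
  move=> _ [B oB <-]; rewrite setTI.
  apply: measurable_open; apply: open_comp => // x _; exact: continuous_mul.
by rewrite -[X in measurable X]setTI; exact: mf.
Qed.

Lemma finite_translates O : compact [set: G] -> open O -> O e ->
  exists l : seq G, forall x, exists2 g, g \in l & translate g O x.
Proof.
rewrite compact_cover => cptG oO Oe.
have [D _ Dcov] := cptG G setT (fun g => translate g O)
   (fun g _ => open_translate g oO)
   (fun x _ => ex_intro2 _ _ x I (ex_intro2 _ _ e Oe (gmulg1 x))).
exists (enum_fset D) => x; have [g gD gOx] := Dcov x I; by exists g.
Qed.

(** Continuity of the product at [(e, e)] gives a box mapped into [U]; an open set inside both of
    its sides is intersected with its own inverse. *)
Lemma nbhs_mul_sub U : nbhs e U -> exists V, [/\ open V, V e,
  (forall x, V x -> V (inv x)) & forall x y, V x -> V y -> U (x ** y)].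
Proof.
case: topG => _ _ _ mul_cont inv_cont nU.
have inve : inv e = e by rewrite -[LHS]gmulg1 gmulVg.
have : nbhs (e, e) [set p : G * G | U (p.1 ** p.2)].
  by apply: mul_cont; rewrite /= gmul1g.
move=> [[A B] [/= nA nB] ABU].
pose W := (A `&` B)^°.
have nW : nbhs e W.
  rewrite /W; apply: open_nbhs_nbhs.
  by split; [exact: open_interior|exact: filterI].
have oW : open W by exact: open_interior.
have We : W e by exact: nbhs_singleton.
have WAB x : W x -> A x /\ B x by move=> /interior_subset.
have invK x : inv (inv x) = x.
  by apply: (@gmulI (inv x)); rewrite gmulgV gmulVg.
exists (W `&` inv @^-1` W); split.
- by apply: openI => //; apply: open_comp => // x _; exact: inv_cont.
- by split=> //=; rewrite inve.
- by move=> x [Wx Wix]; split=> //=; rewrite invK.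
- by move=> x y [/WAB[Ax _] _] [/WAB[_ By] _]; exact: (ABU (x, y)).
Qed.

End Group.

(** * The subgroup generated by a symmetric set, and its cosets *)

Section Subgroup.
Context (G : ptopologicalType) (mul : G -> G -> G) (inv : G -> G) (e : G).
Hypothesis topG : is_topological_group mul inv e.
Local Notation "x ** y" := (mul x y) (at level 40, left associativity).
Local Notation translate g A := (mul g @` A).

(** The least set containing [e] and stable under right multiplication by [V], that is, all finite
    products from [V]; for symmetric [V] it is the generated subgroup. *)
Definition generated (V : set G) : set G := [set x | forall S : set G,
  S e -> (forall y v, S y -> V v -> S (y ** v)) -> S x].

Variable V : set G.
Hypothesis symV : forall x, V x -> V (inv x).
Local Notation H := (generated V).

Lemma generated1 : H e. Proof. by []. Qed.

Lemma generated_mulr x v : H x -> V v -> H (x ** v).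
Proof. by move=> Hx Vv S Se Smul; apply: (Smul) => //; exact: Hx. Qed.

(** Minimality is applied to the set of all [y] with [x ** y] in [H]. *)
Lemma generatedM x y : H x -> H y -> H (x ** y).
Proof.
move=> Hx Hy; apply: (Hy [set y | H (x ** y)]) => /=.
  by rewrite (gmulg1 topG).
by move=> z v Hxz Vv; rewrite (gmulA topG); exact: generated_mulr.
Qed.

Lemma sub_generated : V `<=` H.
Proof.
move=> v Vv; rewrite -(gmul1g topG v).
by apply: generated_mulr => //; exact: generated1.
Qed.

Lemma generatedV x : H x -> H (inv x).
Proof.
move=> Hx; apply: (Hx [set x | H (inv x)]) => /=.
  by rewrite -(gmulg1 topG (inv e)) (gmulVg topG); exact: generated1.
move=> y v Hy Vv; rewrite (ginvM topG); apply: generatedM => //.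
by apply: sub_generated; exact: symV.
Qed.

Lemma translate_generated x y :
  translate x H y -> translate y H = translate x H.
Proof.
move=> [h Hh <-]; apply/seteqP; split=> _ [k Hk <-].
  by exists (h ** k); [exact: generatedM|exact: (gmulA topG)].
exists (inv h ** k); first by apply: generatedM => //; exact: generatedV.
by rewrite -(gmulA topG) (gmulVKg topG).
Qed.

Lemma translate_generated_disjoint x y : ~ translate x H y ->
  translate y H `&` translate x H = set0.
Proof.
move=> nxy; rewrite -subset0 => z [yz xz]; apply: nxy.
rewrite -(translate_generated xz) (translate_generated yz).
by exists e; [exact: generated1|exact: (gmulg1 topG)].
Qed.

End Subgroup.

(** * Haar measure, greedy packings and the tiling of the group *)

Section Haar.
Local Open Scope ring_scope.
Context (R : realType) (G : ptopologicalType)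
  (mul : G -> G -> G) (inv : G -> G) (e : G).
Hypothesis topG : is_topological_group mul inv e.
Hypothesis compactG : compact [set: G].
Variable nu : probability (borel G) R.
Hypothesis haar_nu : is_normalized_haar mul nu.
Implicit Types (x y z g h : G) (A U V O : set G).
Local Notation m := (mass nu).
Local Notation "x ** y" := (mul x y) (at level 40, left associativity).
Local Notation translate g A := (mul g @` A).

Lemma mass_translate g A : measurable (A : set (borel G)) ->
  m (translate g A) = m A.
Proof.
by move=> mA; case: haar_nu => nu_inv _ _; rewrite /mass nu_inv.
Qed.

Lemma mass_le1 (A : set (borel G)) : measurable A -> m A <= 1.
Proof.
by move=> mA; rewrite -lee_fin -massE//; exact: probability_le1.
Qed.

Lemma outer_open (A : set (borel G)) (eps : R) : measurable A -> 0 < eps ->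
  exists O, [/\ open O, A `<=` O & m O < m A + eps].
Proof.
move=> mA eps0; have [_ outer _] := haar_nu.
have [|_ [W [oW AW] <-]] := lb_ereal_inf_adherent eps0
    (S := [set nu O | O in [set O : set (borel G) | @open G O /\ A `<=` O]]).
  by rewrite -outer// fin_num_measure.
rewrite -outer// massE; last exact: measurable_open.
by rewrite massE// -EFinD lte_fin; exists W.
Qed.

(** Otherwise finitely many null translates would cover a space of mass 1. *)
Lemma mass_nbhs_gt0 V : open V -> V e -> 0 < m V.
Proof.
move=> oV Ve; have [l lV] := finite_translates topG compactG oV Ve.
rewrite lt0r mass_ge0 andbT; apply/eqP => V0.
have mV := measurable_open oV.
have : m (union_over l (fun g => translate g V : set (borel G))) <=
    (size l)%:R * 0.
  apply: mass_union_over_le => g _.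
  split; first exact: (measurable_translate topG).
  by rewrite mass_translate// V0.
rewrite (_ : union_over _ _ = setT); last first.
  by apply/seteqP; split=> // x _; exact: lV.
by rewrite mulr0 /mass probability_setT /= ler10.
Qed.

(** Once points are null, outer regularity gives an open set of small mass around [e], and finitely
    many of its translates cover the group. *)
Lemma nondiscrete_finely_coverable : hausdorff_space G ->
  ~ (forall x : G, open [set x]) -> finely_coverable nu.
Proof.
move=> hausG nondiscrete.
have m1 x : measurable ([set x] : set (borel G)).
  rewrite -[[set x]]setCK; apply: measurableC; apply: measurable_open.
  apply: closed_openC; apply: accessible_closed_set1.
  exact: hausdorff_accessible.
have m1x x : m [set x] = m [set e].
  by rewrite -(mass_translate x (m1 e)) image_set1 (gmulg1 topG).
have open1 : ~ open [set e].
  move=> open_e; apply: nondiscrete => x.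
  by rewrite -(gmulg1 topG x) -image_set1; exact: (open_translate topG).
(* An open set around [e] of mass less than [2 * m [set e]] would contain a
   second point, of the same mass as [e]. *)
have m_e : m [set e] = 0.
  apply: contrapT => /eqP m_e0.
  have m_e_gt0 : 0 < m [set e] by rewrite lt0r m_e0 mass_ge0.
  have [W [oW eW mW_lt]] := outer_open (m1 e) m_e_gt0.
  have [x [Wx xe]] : exists x, W x /\ x <> e.
    apply: contrapT => /forallNP Oe; apply: open1.
    rewrite (_ : [set e] = W)//; apply/seteqP; split=> // x Wx.
    by apply: contrapT => xe; exact: (Oe x).
  have : m ([set e] `|` [set x]) <= m W.
    apply: le_mass; [exact: measurableU|exact: measurable_open|].
    by move=> _ [->|->//]; exact: eW.
  rewrite massU// ?m1x; first by lra.
  by rewrite -subset0 => _ [-> /esym].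
move=> eps eps0; have [W [oW eW mW_lt]] := outer_open (m1 e) eps0.
have [l lW] := finite_translates topG compactG oW (eW _ erefl).
have mW := measurable_open oW.
(* Past the end of [l] the default [e] still gives a translate of [W], so every index has small
   mass. *)
exists (size l), (fun i => translate (nth e l i) W); split=> [i|x].
  split; first exact: (measurable_translate topG).
  by rewrite mass_translate// -[leRHS]add0r -m_e ltW.
have [g gl gWx] := lW x.
by exists (index g l); rewrite ?index_mem// nth_index.
Qed.

Variables (U V : set G).
Hypotheses (openV : open V) (V1 : V e) (symV : forall x, V x -> V (inv x)).
Hypothesis V5_sub : forall v1 v2 v3 v4 v5, V v1 -> V v2 -> V v3 -> V v4 ->
  V v5 -> U (v1 ** v2 ** v3 ** v4 ** v5).
Local Notation H := (generated mul e V).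

Definition square : set G := \bigcup_(v in V) translate v V.

Lemma open_square : open square.
Proof. by apply: bigcup_open => v _; exact: (open_translate topG). Qed.

(** The requirement [e \in s] puts [e] into the union of the translates of [square], from where
    minimality of [H] can start. *)
Definition packing (s : seq G) : Prop :=
  [/\ uniq s, e \in s, {in s, forall g, H g},
      chained (fun g => translate g square) (fun g => translate g U) s
    & disjoint_over s (fun g => translate g V)].

Lemma packing1 : packing [:: e].
Proof.
split=> //; first by rewrite mem_head.
- by move=> g; rewrite inE => /eqP ->; exact: generated1.
- by split=> //; left.
- by move=> g h; rewrite !inE => /eqP -> /eqP ->.
Qed.

(** If the union [Y] of the translates of [square] is stable under right multiplication by [V], it
    contains [H]. Otherwise some [y ** v] leaves [Y] and is the new point: were its translate of [V]
    to meet that of some [g] in [s], symmetry of [V] would put it into [g] times [square]. *)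
Lemma packing_extend s : packing s ->
  H `<=` union_over s (fun g => translate g square) \/
  exists g, packing (g :: s).
Proof.
move=> [uniq_s es sH chain_s disj_s].
set Y := union_over s _.
have square1 : square e by exists e => //; exists e => //; exact: (gmul1g topG).
have [closedY|/existsNP[y /existsNP[v]]] :=
    pselect (forall y v, Y y -> V v -> Y (y ** v)).
  left=> x Hx; apply: (Hx Y) => //.
  by exists e => //; exists e => //; exact: (gmul1g topG).
move=> /not_implyP[[p ps [_ [v1 Vv1 [v2 Vv2 <-]] <-]] /not_implyP[Vv nY]].
right; exists (p ** (v1 ** v2) ** v); split=> /=.
- rewrite uniq_s andbT; apply/negP => gs; apply: nY.
  by exists (p ** (v1 ** v2) ** v) => //; exists e => //; exact: (gmulg1 topG).
- by rewrite inE es orbT.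
- move=> g; rewrite inE => /predU1P[->|]; last exact: sH.
  apply: generated_mulr => //; rewrite (gmulA topG).
  by do 2!apply: generated_mulr => //; exact: sH.
(* Five factors from [V]: two lead from [p] to [y], one to the new point, and two through its
   translate of [square]. *)
- split=> //; right; exists p => // _ [_ [v3 Vv3 [v4 Vv4 <-]] <-].
  exists (v1 ** v2 ** v ** v3 ** v4); first exact: V5_sub.
  by rewrite !(gmulA topG).
- have disj g : g \in s ->
      translate (p ** (v1 ** v2) ** v) V `&` translate g V = set0.
    move=> gs; rewrite -subset0 => _ [[a Va <-] [b Vb ab]]; apply: nY.
    exists g => //; exists (b ** inv a).
      by exists b => //; exists (inv a) => //; exact: symV.
    by rewrite (gmulA topG) ab -(gmulA topG _ a) (gmulgV topG) (gmulg1 topG).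
  move=> g h; rewrite !inE => /predU1P[->|gs] /predU1P[->|hs] // gh.
  + exact: disj.
  + by rewrite setIC; exact: disj.
  + exact: disj_s.
Qed.

(** If no packing covers [H], packings grow without bound, although their disjoint translates of [V]
    have equal positive mass and total mass at most 1. *)
Lemma packing_covers : exists s, packing s /\
  union_over s (fun g => translate g square) = H.
Proof.
suff [s [pack_s Hs]] : exists s, packing s /\
    H `<=` union_over s (fun g => translate g square).
  exists s; split=> //; apply/seteqP; split=> // x [g gs [y]].
  move=> [v1 Vv1 [v2 Vv2 <-]] <-.
  have [_ _ sH _ _] := pack_s.
  rewrite (gmulA topG); do 2!apply: generated_mulr => //; exact: sH.
apply: contrapT => no_cover.
have large n : exists s, packing s /\ (n < size s)%N.
  elim: n => [|n [s [pack_s size_s]]].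
    by exists [:: e]; split=> //; exact: packing1.
  case: (packing_extend pack_s) => [Hs|[g pack_gs]].
    by case: no_cover; exists s.
  by exists (g :: s).
have mV := measurable_open openV.
have mV0 := mass_nbhs_gt0 openV V1.
(* This length exceeds the inverse of [m V]. *)
have [s [[uniq_s _ _ _ disj_s]]] := large (Num.truncn (m V)^-1).
have bound := @size_disjoint_le _ _ _ nu _ s
  (fun g => translate g V : set (borel G)) (m V) uniq_s disj_s.
apply/negP; rewrite -leqNgt truncn_ge_nat; last by rewrite invr_ge0 ltW.
rewrite -[leRHS]mul1r ler_pdivlMr//; apply: le_trans (bound _) _.
  move=> g _; split; first exact: (measurable_translate topG).
  by rewrite mass_translate.
apply: mass_le1; apply: measurable_union_over => g _.
exact: (measurable_translate topG).
Qed.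

Definition small (P : set G) := exists g, P `<=` translate g U.

(** Left invariance keeps the masses, and a piece inside [h U] moves into [(g ** h) U]. *)
Lemma tiled_translate delta g S :
  @tiled _ (borel G) R nu small delta S ->
  @tiled _ (borel G) R nu small delta (translate g S).
Proof.
move=> [Pp [[finP nP tP UP] hP]].
exists [set translate g P | P in Pp]; split; last first.
  move=> _ [P /hP[mP massP [h Ph]] <-]; split.
  - exact: (measurable_translate topG).
  - by rewrite mass_translate.
  - exists (g ** h) => _ [x /Ph[u Uu <-] <-]; exists u => //.
    by rewrite (gmulA topG).
split.
- exact: finite_image.
- move=> [P PP gP0]; suff P0 : P = set0 by rewrite P0 in PP.
  rewrite -subset0 => x Px; suff : set0 (g ** x) by [].
  by rewrite -gP0; exists x.
- move=> _ _ [P PP <-] [P' PP' <-] PP'_neq.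
  rewrite -subset0 => _ [[x Px <-] [y P'y /(gmulI topG) yx]].
  suff : set0 x by [].
  rewrite -(tP P P' PP PP'); first by split; [exact: Px|rewrite -yx].
  by move=> PP'E; apply: PP'_neq; rewrite PP'E.
- rewrite -UP; apply/seteqP; split.
    by move=> _ [_ [P PP <-] [x Px <-]]; exists x => //; exists P.
  by move=> _ [x [P PP Px] <-]; exists (translate g P); [exists P|exists x].
Qed.

Lemma open_generated : open H.
Proof.
have [s [_ <-]] := packing_covers.
rewrite (_ : union_over _ _ = \bigcup_(g in [set` s]) translate g square)//.
by apply: bigcup_open => g _; apply: (open_translate topG); exact: open_square.
Qed.

Lemma tiled_generated : finely_coverable nu ->
  exists2 delta, 0 < delta & @tiled _ (borel G) R nu small delta H.
Proof.
move=> fine_cover.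
have [s [[uniq_s es sH chain_s disj_s] coverH]] := packing_covers.
have mV0 := mass_nbhs_gt0 openV V1.
have mV := measurable_open openV; have mS := measurable_open open_square.
have mT g (A : set (borel G)) :
    measurable A -> measurable (translate g A : set (borel G)).
  exact: (measurable_translate topG).
have H1 : H e by exact: generated1.
have mH0 := mass_nbhs_gt0 open_generated H1.
have VS : V `<=` square.
  by move=> v Vv; exists e => //; exists v => //; exact: (gmul1g topG).
(* Products of two factors are padded with [e] to five. *)
have SU : square `<=` U.
  move=> _ [v Vv [w Vw <-]].
  by have := V5_sub V1 V1 V1 Vv Vw; rewrite !(gmul1g topG).
have transS g A B : A `<=` B -> translate g A `<=` translate g B.
  by move=> AB _ [x /AB Bx <-]; exists x.
have [|A [hA disjA UA]] := @disjoint_between _ (borel G) _ s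
  (fun g => translate g V) (fun g => translate g square) uniq_s disj_s.
  move=> g _; split; [exact: mT|exact: mT|exact: transS].
(* [N] exceeds [m H / m V], so [m H / N] is less than [m V], the mass of the translate of [V] inside
   each cell. *)
pose N := (Num.truncn (m H / m V)).+1.
have N_gt : m H / m V < N%:R.
  by have /andP[] := truncn_itv (divr_ge0 (ltW mH0) (ltW mV0)).
have N0 : 0 < N%:R :> R by rewrite ltr0n.
have delta0 : 0 < m H / N%:R by rewrite divr_gt0.
exists (m H / N%:R) => //.
suff : @tiled _ (borel G) R nu small (m H / N%:R) (union_over s A).
  by rewrite UA coverH.
apply: (@tiled_chain _ (borel G) R nu small _ delta0 fine_cover _
  (fun g => translate g square) (fun g => translate g U) s A N) => //.
- by move=> g P PU; exists g.
- by move=> g _; exact: mT.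
- move=> g gs; have [mA VA AS] := hA g gs; split=> //.
    by move=> x /AS; exact: transS.
  apply: (@le_trans _ _ (m V)).
    by rewrite ler_pdivrMr// mulrC -ler_pdivrMr// ltW.
  rewrite -(mass_translate g)//; apply: le_mass; first exact: mT.
    by apply: measurableI => //; exact: mT.
  by move=> x Vx; split; [exact: VA|exact: transS Vx].
- by rewrite UA coverH mulrC divfK// gt_eqF.
Qed.

(** The same [delta] serves every coset of [H]. Finitely many cosets cover the group; each new one
    is either already present or disjoint from the earlier ones. *)
Lemma tiled_setT : finely_coverable nu ->
  exists2 delta, 0 < delta & @tiled _ (borel G) R nu small delta setT.
Proof.
move=> /tiled_generated[delta delta0 tiledH]; exists delta => //.
have H1 : H e by exact: generated1.
have [l lH] := finite_translates topG compactG open_generated H1.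
rewrite (_ : setT = union_over l (fun g => translate g H)); last first.
  by apply/seteqP; split=> // x _; exact: lH.
elim: l {lH} => [|g l IHl].
  rewrite (_ : union_over _ _ = set0); first exact: tiled0.
  by rewrite -subset0 => x [].
rewrite union_over_cons.
have [[h hl hg]|ng] := pselect (union_over l (fun g => translate g H) g).
  rewrite setUidr// (translate_generated topG symV hg) => x hx; by exists h.
apply: tiledU => //; last exact: tiled_translate.
rewrite -subset0 => x [gx [h hl hx]].
rewrite -(translate_generated_disjoint topG symV (x := h) (y := g)).
  by split; [exact: gx|exact: hx].
by move=> hg; apply: ng; exists h.
Qed.

End Haar.

Theorem theorem2 (R : realType) (G : ptopologicalType)
  (mul : G -> G -> G) (inv : G -> G) (e : G)
  (HG : is_compact_group mul inv e)
  (Hnd : ~ (forall x : G, open [set x]))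
  (nu : probability (borel G) R)
  (Hnu : is_normalized_haar mul nu) :
  forall U : set G, nbhs e U ->
  exists Pp : set (set G),
    [/\ finite_partition [set: G] Pp,
        (forall P, Pp P -> haar_measurable nu P),
        U_fine mul U Pp
      & equisize nu Pp].
Proof.
move=> U nU; have [topG hausG compactG] := HG.
(* Three successive square roots of [U] would allow products of eight factors; five are needed, and
   [e] fills the gaps. *)
have [V1 [oV1 V1e _ V1U]] := nbhs_mul_sub topG nU.
have [V2 [oV2 V2e _ V2V1]] := nbhs_mul_sub topG (open_nbhs_nbhs (conj oV1 V1e)).
have [V [oV Ve symV VV2]] := nbhs_mul_sub topG (open_nbhs_nbhs (conj oV2 V2e)).
have V5 v1 v2 v3 v4 v5 : V v1 -> V v2 -> V v3 -> V v4 -> V v5 ->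
    U (mul (mul (mul (mul v1 v2) v3) v4) v5).
  move=> Vv1 Vv2 Vv3 Vv4 Vv5; apply: V1U.
    by rewrite -(gmulA topG (mul v1 v2)); apply: V2V1; exact: VV2.
  rewrite -(gmul1g topG v5); apply: V2V1 => //.
  by rewrite -(gmul1g topG v5); exact: VV2.
have fine_cover := nondiscrete_finely_coverable topG compactG Hnu hausG Hnd.
have [delta delta0 [Pp [partPp hPp]]] :=
  tiled_setT topG compactG Hnu oV Ve symV V5 fine_cover.
(* The pieces are Borel, so each one serves as both of its sandwiching sets. *)
have haarP P : Pp P -> haar_measure_is nu P delta%:E.
  move=> /hPp[mP massP _]; exists P, P; rewrite setDv measure0 massE// massP.
  by split=> //; split.
exists Pp; split=> //.
- by move=> P /haarP; exists delta%:E.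
- by move=> P /hPp[].
- by exists delta%:E.
Qed.
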